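(* Let $\alpha\in(0,1)$, $\theta\in[0,1]$, and suppose $(X_t)_{t=1}^\infty\sim P$ for some $P\in\mathcal P^\mu$, $\mu\in[0,1]$. Let $(\tilde\lambda^+_t)_{t=1}^\infty$ and $(\tilde\lambda^-_t)_{t=1}^\infty$ be real-valued predictable sequences not depending on $m$, and for each $t\ge1$ and $m\in[0,1]$ let $$\lambda_t^+(m):=|\tilde\lambda_t^+|\wedge\frac{c}{m},\qquad \lambda_t^-(m):=|\tilde\lambda_t^-|\wedge\frac{c}{1-m},$$ for some $c\in[0,1)$. Define $$\mathcal K_t^+(m):=\prod_{i=1}^t\bigl(1+\lambda_i^+(m)(X_i-m)\bigr),\qquad \mathcal K_t^-(m):=\prod_{i=1}^t\bigl(1-\lambda_i^-(m)(X_i-m)\bigr),$$ $$\mathcal K_t^\pm(m):=\max\{\theta\mathcal K_t^+(m),(1-\theta)\mathcal K_t^-(m)\},\qquad \mathcal M_t^\pm(m):=\theta\mathcal K_t^+(m)+(1-\theta)\mathcal K_t^-(m).$$ Then $$\mathfrak B_t^\pm:=\{m\in[0,1]:\mathcal K_t^\pm(m)<1/\alpha\}$$ forms a $(1-\alpha)$-confidence sequence for $\mu$, as does its running intersection $\bigcap_{i\le t}\mathfrak B_i^\pm$. Further, $\mathfrak B_t^\pm$ is an interval for each $t\ge1$. Finally, replacing $\mathcal K_t^\pm(m)$ by $\mathcal M_t^\pm(m)$ yields a tighter $(1-\alpha)$-confidence sequence for $\mu$; that is, $\{m\in[0,1]:\mathcal M_t^\pm(m)<1/\alpha\}$, $t\ge1$,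 is also a $(1-\alpha)$-confidence sequence for $\mu$ and is contained in $\mathfrak B_t^\pm$ for each $t$.
   Context: $\mathcal F_t=\sigma(X_1,\dots,X_t)$, $\mathcal F_0$ trivial. $\mathcal P^\mu$ is the set of all distributions $P$ on $[0,1]^\infty$ such that $\mathbb E_P(X_t\mid\mathcal F_{t-1})=\mu$ for every $t\ge1$. A sequence $(\lambda_t)$ is predictable if $\lambda_t$ is $\mathcal F_{t-1}$-measurable for each $t\ge1$. $a\wedge b=\min(a,b)$. $c/m$ is interpreted as $+\infty$ when $m=0$, and $c/(1-m)$ as $+\infty$ when $m=1$. A sequence of random sets $(C_t)_{t\ge1}$, with $C_t$ determined by $X_1,\dots,X_t$, is a $(1-\alpha)$-confidence sequence for $\mu$ if $\sup_{P\in\mathcal P^\mu}P(\exists t\ge1:\mu\notin C_t)\le\alpha$. An interval means a convex subset of $[0,1]$ (possibly empty). *)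

(* Defs.v *)
From HB Require Import structures.
From mathcomp Require Export all_boot all_order all_algebra.
From mathcomp Require Export all_classical all_reals all_analysis.

Set Implicit Arguments.
Unset Strict Implicit.
Unset Printing Implicit Defensive.
Import Order.TTheory GRing.Theory Num.Theory.

Local Open Scope classical_set_scope.
Local Open Scope ring_scope.

Definition unit_seq (R : realType) : Type := nat -> {i01 R}.

HB.instance Definition _ (R : realType) := Choice.on (unit_seq R).
HB.instance Definition _ (R : realType) :=
  isPointed.Build (unit_seq R) (fun=> 0%:i01).

(* Coordinates are numbered from 0: [coord n] is the observation X_{n+1}. *)
Definition coord (R : realType) (n : nat) (x : unit_seq R) : R := (x n)%:num.

(* [0,1]^oo with the product Borel sigma-algebra. *)
Notation sample_space R := (g_sigma_algebraType
  (\bigcup_n preimage_set_system [set: unit_seq R] (@coord R n) measurable)).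

(* sigma(X_1, ..., X_t); it is trivial for t = 0. *)
Definition history (R : realType) (t : nat) : set (set (sample_space R)) :=
  g_sigma_preimage (fun i : 'I_t => @coord R i).
Arguments history {R} t.

Definition measurable_wrt (R : realType) (T : pointedType) (G : set (set T))
    (f : T -> R) : Prop :=
  measurable_fun [set: g_sigma_algebraType G] f.

(* Y is a version of E_P(X | G); G is meant to be a sub-sigma-algebra of the
   measurable sets and X to be P-integrable. *)
Definition is_cond_expectation (d : measure_display) (T : measurableType d)
    (R : realType) (P : probability T R) (G : set (set T)) (X Y : T -> R) : Prop :=
  [/\ measurable_wrt G Y,
      P.-integrable setT (EFin \o Y) &
      forall A, G A ->
        (\int[P]_(w in A) (Y w)%:E = \int[P]_(w in A) (X w)%:E)%E].

Definition mean_class (R : realType) (mu : R) :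
    set (probability (sample_space R) R) :=
  [set P | forall t, is_cond_expectation P (history t) (coord t) (cst mu)].

(* [l n] is the (n+1)-st term of the sequence, hence measurable with respect to
   the first n observations. *)
Definition predictable (R : realType) (l : nat -> sample_space R -> R) : Prop :=
  forall n, measurable_wrt (history n) (l n).

(* [C t] is only constrained for t >= 1.  That it is determined by X_1, ..., X_t
   is read as: for each real m, the event that C_t contains m lies in
   sigma(X_1, ..., X_t).  In particular the noncoverage event is measurable. *)
Definition confidence_sequence (R : realType) (alpha mu : R)
    (C : nat -> sample_space R -> set R) : Prop :=
  (forall t m, (0 < t)%N -> history t [set w | C t w m]) /\
  (ereal_sup [set P [set w | exists2 t, (0 < t)%N & ~ C t w mu]
             | P in mean_class mu] <= alpha%:E)%E.

Definition running_intersection (R : realType)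
    (C : nat -> sample_space R -> set R) (t : nat) (w : sample_space R) : set R :=
  \bigcap_(i in [set i | (0 < i <= t)%N]) C i w.

(* A convex subset of [0,1], possibly empty. *)
Definition interval01 (R : realType) (A : set R) : Prop :=
  A `<=` `[0, 1]%classic /\ convex_set (A : set (convex_lmodType R^o)).

(* c / d with the convention c / 0 = +oo, also when c = 0. *)
Definition ratio (R : realType) (c d : R) : \bar R :=
  if d == 0 then +oo%E else (c / d)%:E.

Section processes.
Context {R : realType}.
Implicit Types (c theta m : R) (l lp lm : nat -> sample_space R -> R).

(* The minimum is always finite, so [fine] loses nothing. *)
Definition lambda_plus c l m (n : nat) (w : sample_space R) : R :=
  fine (Order.min `|l n w|%:E (ratio c m)).

Definition lambda_minus c l m (n : nat) (w : sample_space R) : R :=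
  fine (Order.min `|l n w|%:E (ratio c (1 - m))).

Definition K_plus c l (t : nat) m (w : sample_space R) : R :=
  \prod_(i < t) (1 + lambda_plus c l m i w * (coord i w - m)).

Definition K_minus c l (t : nat) m (w : sample_space R) : R :=
  \prod_(i < t) (1 - lambda_minus c l m i w * (coord i w - m)).

Definition K_pm theta c lp lm (t : nat) m (w : sample_space R) : R :=
  Num.max (theta * K_plus c lp t m w) ((1 - theta) * K_minus c lm t m w).

Definition M_pm theta c lp lm (t : nat) m (w : sample_space R) : R :=
  theta * K_plus c lp t m w + (1 - theta) * K_minus c lm t m w.

Definition B_pm alpha theta c lp lm (t : nat) (w : sample_space R) : set R :=
  [set m | 0 <= m <= 1 /\ K_pm theta c lp lm t m w < 1 / alpha].

Definition BM_pm alpha theta c lp lm (t : nat) (w : sample_space R) : set R :=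
  [set m | 0 <= m <= 1 /\ M_pm theta c lp lm t m w < 1 / alpha].

End processes.

(* Main.v *)
Require Import Defs.
From mathcomp Require Import measurable_realfun ring lra.
Import Order.TTheory GRing.Theory Num.Theory.
Set Implicit Arguments.
Unset Strict Implicit.
Unset Printing Implicit Defensive.
Local Open Scope classical_set_scope.
Local Open Scope ring_scope.

(** Fix the true mean [mu] and a law in [mean_class mu].  Both capital
processes have the shape [wealth kappa Y nu], the fortune of a gambler who
stakes a predictable fraction [kappa n] on the increment [Y n - nu], where
[Y n >= 0] has conditional mean [nu]: for [K_plus] take [Y = X], [nu = mu], and
for [K_minus] take [Y = 1 - X], [nu = 1 - mu] ([K_minusE]).  The truncation of
the stakes gives [kappa n * nu <= c < 1], so the fortune stays nonnegative.

The fortune is a martingale even when the stakes are unbounded (which happens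
at [mu = 0] or [mu = 1]).  The factor [1 + kappa * (Y - nu)] splits as
[(1 - kappa * nu) + kappa * Y], a sum of two nonnegative terms, so all
the integrals live in [[0, +oo]], where additivity and monotone convergence
always hold ([pull_out], [wealth_martingale]).

Hence the mixture [M_pm] is a nonnegative martingale started at [1], and
Ville's inequality ([ville]) bounds by [alpha] the probability that it ever
reaches [1 / alpha].  Before that happens [mu] lies in every [BM_pm].  The sets
[B_pm] contain the sets [BM_pm], because the maximum of two nonnegative numbers
is at most their sum, so they inherit the coverage; and a running intersection
misses [mu] at some time exactly when one of the original sets does.

Finally each factor of [K_plus] is nonnegative and nonincreasing in [m], since
the stake [min(|l|, c/m)] decreases in [m] while its product with [m], namely
[min(|l| m, c)], increases ([wealth_antitone]).  By the symmetry above [K_minus]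
is nondecreasing, so a sublevel set of the maximum of the two is convex. *)

(** * Sub-sigma-algebras and filtrations *)

Definition sub_sigma_field (d : measure_display) (T : measurableType d)
    (G : set (set T)) : Prop :=
  sigma_algebra setT G /\ G `<=` measurable.

Definition filtration (d : measure_display) (T : measurableType d)
    (F : nat -> set (set T)) : Prop :=
  (forall n, sub_sigma_field (F n)) /\ (forall n, F n `<=` F n.+1).

Section measurability.
Context {d : measure_display} {T : measurableType d} {R : realType}.
Implicit Types (G H : set (set T)) (f : T -> R).

Lemma measurable_wrt_preimage G f (B : set R) :
  sigma_algebra setT G -> measurable_wrt G f -> measurable B -> G (f @^-1` B).
Proof.
move=> sG mf mB; rewrite -[G]measurable_g_measurableTypeE//.
by rewrite -[X in measurable X]setTI; exact: mf.
Qed.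

Lemma measurable_wrtW G H f :
  sigma_algebra setT G -> G `<=` H -> measurable_wrt G f -> measurable_wrt H f.
Proof.
move=> sG GH mf _ B mB; rewrite setTI.
by apply: sub_sigma_algebra; apply: GH; exact: measurable_wrt_preimage.
Qed.

Lemma measurable_wrt_fun G f :
  sub_sigma_field G -> measurable_wrt G f -> measurable_fun setT f.
Proof.
move=> [sG GM] mf _ B mB; rewrite setTI.
by apply: GM; exact: measurable_wrt_preimage.
Qed.

End measurability.

(** * Conditional means of nonnegative variables *)

Section pull_out.
Context {d : measure_display} {T : measurableType d} {R : realType}.
Variables (P : probability T R) (G : set (set T)) (Y : T -> R) (nu : R).
Hypotheses (hG : sub_sigma_field G).
Hypotheses (mY : measurable_fun setT Y) (Y0 : forall w, 0 <= Y w).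
Hypothesis condY :
  forall A, G A -> (\int[P]_(w in A) (Y w)%:E = nu%:E * P A)%E.

Import HBNNSimple.

(** A simple function is a finite combination of indicators of events of [G],
and on each of these the identity is the definition of the conditional mean. *)
Lemma pull_out_simple (h : {nnsfun (g_sigma_algebraType G) >-> R}) :
  (\int[P]_w (h w * Y w)%:E = nu%:E * \int[P]_w (h w)%:E)%E.
Proof.
have Gh (y : R) : G (h @^-1` [set y]).
  by apply: measurable_wrt_preimage => //; [case: hG|exact: measurable_funPT].
have mGh (y : R) : d.-measurable (h @^-1` [set y]) by case: hG => _; apply.
have hE w : h w = \sum_(y \in range h) y * \1_(h @^-1` [set y]) w.
  exact: fimfunE.
have term0 (y : R) w : 0 <= y * \1_(h @^-1` [set y]) w.
  rewrite indicE; case: (boolP (w \in _)); last by rewrite mulr0.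
  by rewrite inE mulr1 => <-.
have m1 (y : R) : measurable_fun setT (fun w : T => y * \1_(h @^-1` [set y]) w).
  by apply: measurable_funM => //; exact: measurable_indic.
transitivity (\int[P]_w
    \sum_(y \in range h) (y * \1_(h @^-1` [set y]) w * Y w)%:E)%E.
  apply: eq_integral => w _; rewrite hE fsumEFin//; congr EFin.
  by rewrite mulrC fsbig_distrr//=; apply: eq_fsbigr => y _; rewrite mulrC.
rewrite ge0_integral_fsum//=; first last.
- by move=> y w _; rewrite lee_fin mulr_ge0.
- by move=> y; apply/measurable_EFinP/measurable_funM.
transitivity (nu%:E * \int[P]_w
    \sum_(y \in range h) (y * \1_(h @^-1` [set y]) w)%:E)%E; last first.
  by congr (_ * _)%E; apply: eq_integral => w _; rewrite hE fsumEFin.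
rewrite ge0_integral_fsum//=; first last.
- by move=> y w _; rewrite lee_fin.
- by move=> y; apply/measurable_EFinP.
rewrite ge0_mule_fsumr; last first.
  by move=> y; apply: integral_ge0 => w _; rewrite lee_fin.
apply: eq_fsbigr => y; rewrite inE => -[w _ <-{y}].
have hw0 : 0 <= h w by [].
set A := h @^-1` _.
transitivity ((h w)%:E * \int[P]_(x in A) (Y x)%:E)%E.
  rewrite [in RHS]integral_mkcond -ge0_integralZl//=; first last.
  - by move=> x _; rewrite patchE; case: ifP; rewrite // lee_fin.
  - apply/(measurable_restrictT _ (mGh _)).1.
    by apply/measurable_EFinP/measurable_funTS.
  apply: eq_integral => x _; rewrite patchE indicE.
  by case: ifP => _; rewrite ?mule0 ?mulr0 ?mul0r// mulr1 EFinM.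
rewrite condY; last exact: Gh.
rewrite muleCA; congr (_ * _)%E.
under [RHS]eq_integral do rewrite EFinM.
rewrite ge0_integralZl//=; last first.
  by apply/measurable_EFinP; apply: measurable_indic; exact: mGh.
by rewrite integral_indic ?setIT//; exact: mGh.
Qed.

(** Known factors can be pulled out of a constant conditional mean.  Both sides
are integrals of nonnegative functions, so monotone convergence from simple
functions suffices and [Z] may have infinite mean. *)
Lemma pull_out (Z : T -> R) :
  measurable_wrt G Z -> (forall w, 0 <= Z w) ->
  (\int[P]_w (Z w * Y w)%:E = nu%:E * \int[P]_w (Z w)%:E)%E.
Proof.
move=> mZ Z0.
have mZ' : measurable_fun [set: g_sigma_algebraType G] (EFin \o Z).
  exact/measurable_EFinP.
pose h := nnsfun_approx measurableT mZ'.
have mh k : measurable_fun setT (h k : T -> R).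
  by apply: (measurable_wrt_fun hG); exact: measurable_funPT.
have cvgh w : (h k w)%:E @[k --> \oo] --> (Z w)%:E.
  by apply: (cvg_nnsfun_approx measurableT mZ') => // x _; rewrite lee_fin.
have ndh w : {homo (fun k => (h k w)%:E) : n m / (n <= m)%N >-> (n <= m)%E}.
  move=> n m nm; rewrite lee_fin.
  by have /lefP := nd_nnsfun_approx measurableT mZ' nm; exact.
have L : (\int[P]_w (h k w * Y w)%:E)%E @[k --> \oo] -->
         (\int[P]_w (Z w * Y w)%:E)%E.
  rewrite (_ : (\int[P]_w (Z w * Y w)%:E)%E =
      (\int[P]_w limn (fun k => (h k w * Y w)%:E))%E).
    apply: cvg_monotone_convergence => //.
    - by move=> k; apply/measurable_EFinP/measurable_funM.
    - by move=> k w _; rewrite lee_fin mulr_ge0.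
    - move=> w _ n m nm; rewrite lee_fin ler_wpM2r//.
      by rewrite -lee_fin; exact: ndh.
  apply: eq_integral => w _; apply/esym/cvg_lim => //.
  under eq_fun do rewrite EFinM.
  rewrite EFinM; apply: cvgeMr => //.
have Rr : (nu%:E * \int[P]_w (h k w)%:E)%E @[k --> \oo] -->
         (nu%:E * \int[P]_w (Z w)%:E)%E.
  apply: cvgeMl => //.
  rewrite (_ : (\int[P]_w (Z w)%:E)%E =
      (\int[P]_w limn (fun k => (h k w)%:E))%E).
    apply: cvg_monotone_convergence => //.
    - by move=> k; apply/measurable_EFinP.
    - by move=> k w _; rewrite lee_fin.
  by apply: eq_integral => w _; apply/esym/cvg_lim.
apply: (cvg_unique _ L) => //=.
by rewrite (eq_cvg _ _ (fun k => pull_out_simple (h k))).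
Qed.

End pull_out.

(** * Ville's inequality *)

Section ville.
Context {d : measure_display} {T : measurableType d} {R : realType}.
Variables (P : probability T R) (F : nat -> set (set T)).
Hypothesis hF : filtration F.

Lemma filtration_sigma_algebra n : sigma_algebra setT (F n).
Proof. by case: hF => /(_ n)[]. Qed.

Lemma filtration_measurable n A : F n A -> measurable A.
Proof. by case: hF => /(_ n)[_ + _]; exact. Qed.

Lemma filtration_setI n A B : F n A -> F n B -> F n (A `&` B).
Proof.
have := filtration_sigma_algebra n => /measurable_g_measurableTypeE <-.
exact: measurableI.
Qed.

Lemma adapted_measurable (f : T -> R) n :
  measurable_wrt (F n) f -> measurable_fun setT f.
Proof. by apply: measurable_wrt_fun; case: hF. Qed.

Lemma filtration_le m n : (m <= n)%N -> F m `<=` F n.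
Proof.
move=> /subnK <-; elim: (n - m)%N => // k IH.
by apply: subset_trans IH _; case: hF => _; exact.
Qed.

Lemma adapted_later (f : T -> R) m n :
  (m <= n)%N -> measurable_wrt (F m) f -> measurable_wrt (F n) f.
Proof.
move=> /filtration_le; apply: measurable_wrtW.
exact: filtration_sigma_algebra.
Qed.

(** Markov's inequality on the part of [D] where [f] is at least [a], keeping
the integral over the remaining part instead of discarding it. *)
Lemma integral_threshold (D : set T) (f : T -> R) (a : R) :
  measurable D -> measurable_fun setT f -> (forall w, 0 <= f w) -> 0 <= a ->
  (a%:E * P (D `&` ~` [set w | (f w < a)%R]) +
   \int[P]_(w in D `&` [set w | (f w < a)%R]) (f w)%:E <=
   \int[P]_(w in D) (f w)%:E)%E.
Proof.
move=> mD mf f0 a0; set B := [set w | _].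
have mB : measurable B.
  have -> : B = f @^-1` `]-oo, a[ by apply/seteqP; split=> w; rewrite /= in_itv.
  by rewrite -[X in measurable X]setTI; exact: mf.
have mDB : measurable (D `&` B) by exact: measurableI.
have mDBc : measurable (D `&` ~` B).
  by apply: measurableI => //; exact: measurableC.
have mfE A : measurable_fun A (EFin \o f).
  by apply/measurable_EFinP; exact: measurable_funTS.
have f0E (A : set T) w : A w -> (0 <= (f w)%:E)%E by rewrite lee_fin.
have -> : (\int[P]_(w in D) (f w)%:E =
    \int[P]_(w in D `&` ~` B) (f w)%:E + \int[P]_(w in D `&` B) (f w)%:E)%E.
  rewrite -[in LHS](setIT D) -(setvU B) setIUr.
  rewrite ge0_integral_setU//; first exact: f0E.
  by apply/disj_setPS => w [[_ /= nBw] [_]].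
rewrite leeD2r// -integral_cst//; apply: ge0_le_integral => //.
by move=> w [_ /negP]; rewrite -leNgt lee_fin.
Qed.

Variable M : nat -> T -> R.
Hypothesis adaptedM : forall n, measurable_wrt (F n) (M n).
Hypothesis M0 : forall n w, 0 <= M n w.
Hypothesis superM : forall n E, F n E ->
  (\int[P]_(w in E) (M n.+1 w)%:E <= \int[P]_(w in E) (M n w)%:E)%E.

Definition below (a : R) n : set T :=
  [set w | forall k, (k <= n)%N -> M k w < a].

Lemma below0 a : below a 0 = [set w | M 0 w < a].
Proof.
apply/seteqP; split=> w /=; first exact.
by move=> h k; rewrite leqn0 => /eqP ->.
Qed.

Lemma belowS a n : below a n.+1 = below a n `&` [set w | M n.+1 w < a].
Proof.
apply/seteqP; split=> [w h|w [h1 h2] k].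
  by split=> [k kn|]; apply: h => //; exact: leqW.
by rewrite leq_eqVlt => /predU1P[->//|]; exact: h1.
Qed.

(** The event of not having crossed yet is known at time [n], so the
supermartingale inequality may be applied on it. *)
Lemma adapted_below a n : F n (below a n).
Proof.
have lt_F k : F k [set w | M k w < a].
  have -> : [set w | M k w < a] = M k @^-1` `]-oo, a[.
    by apply/seteqP; split=> w; rewrite /= in_itv.
  by apply: measurable_wrt_preimage => //; exact: filtration_sigma_algebra.
elim: n => [|n IH]; first by rewrite below0.
rewrite belowS; apply: filtration_setI => //.
by case: hF => _; apply.
Qed.

(** The capital held at time [n] where the threshold has not been reached pays
for the crossings still to come: at each step the supermartingale property lets
the capital only decrease, and the newly crossing part of it is worth at least
[a] times its probability. *)
Lemma ville_finite (a : R) n : 0 <= a ->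
  (a%:E * P (~` below a n) + \int[P]_(w in below a n) (M n w)%:E <=
   \int[P]_w (M 0%N w)%:E)%E.
Proof.
move=> a0.
have mM k : measurable_fun setT (M k).
  exact: adapted_measurable (@adaptedM k).
have mb k : measurable (below a k) := filtration_measurable (adapted_below a k).
elim: n => [|n]; first by rewrite below0 -[X in P X]setTI
  -[X in (\int[_]_(_ in X) _)%E]setTI; exact: integral_threshold.
apply: le_trans; rewrite belowS setCI.
have -> : ~` below a n `|` ~` [set w | M n.+1 w < a] =
    ~` below a n `|` (below a n `&` ~` [set w | M n.+1 w < a]).
  by rewrite setUIr setvU setTI.
have mbc : measurable (~` below a n) by exact: measurableC.
have mhit : measurable (below a n `&` ~` [set w | M n.+1 w < a]).
  have -> : below a n `&` ~` [set w | M n.+1 w < a] =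
      below a n `\` below a n.+1.
    by rewrite belowS setDE setCI setIUr setICr set0U.
  exact: measurableD.
rewrite measureU//; last first.
  by apply/seteqP; split=> w // [/= nb []].
rewrite ge0_muleDr//.
rewrite -addeA leeD2l//; apply: le_trans (superM (adapted_below a n)).
exact: integral_threshold.
Qed.

Lemma crossingE (a : R) :
  [set w | exists n, a <= M n w] = \bigcup_n ~` below a n.
Proof.
apply/seteqP; split=> w /=.
  by move=> [n an]; exists n => //= /(_ n (leqnn n)); rewrite ltNge an.
move=> [n _ /existsNP[k /not_implyP[_ /negP]]]; rewrite -leNgt => ak.
by exists k.
Qed.

Lemma measurable_crossing (a : R) : measurable [set w | exists n, a <= M n w].
Proof.
rewrite crossingE; apply: bigcupT_measurable => n.
by apply: measurableC; exact: (filtration_measurable (adapted_below a n)).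
Qed.

(** Limit of the finite-horizon bound, by continuity from below. *)
Lemma ville (a : R) : 0 <= a ->
  (a%:E * P [set w | exists n, (a <= M n w)%R] <= \int[P]_w (M 0%N w)%:E)%E.
Proof.
move=> a0; have mU := measurable_crossing a; rewrite crossingE in mU *.
have mb k : measurable (~` below a k).
  by apply: measurableC; apply: filtration_measurable (adapted_below a k).
have nd : {homo (fun n => ~` below a n) : n m / (n <= m)%N >-> (n <= m)%O}.
  move=> n m nm; rewrite subsetEset; apply: subsetC => w h k kn.
  by apply: h; exact: leq_trans nm.
have : (a%:E * P (~` below a n))%E @[n --> \oo] -->
    (a%:E * P (\bigcup_n ~` below a n))%E.
  by apply: cvgeMl => //; exact: nondecreasing_cvg_mu.
move=> cvgP; rewrite -(cvg_lim _ cvgP)//; apply: lime_le.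
  by apply/cvg_ex; eexists; exact: cvgP.
apply: nearW => n; apply: le_trans (ville_finite n a0).
by rewrite leeDl//; apply: integral_ge0 => w _; rewrite lee_fin.
Qed.

End ville.

(** * The betting martingale *)

Definition wealth (T : Type) (R : realType) (kappa Y : nat -> T -> R) (nu : R)
    (n : nat) (w : T) : R :=
  \prod_(i < n) (1 + kappa i w * (Y i w - nu)).

Section wealth_martingale.
Context {d : measure_display} {T : measurableType d} {R : realType}.
Variables (F : nat -> set (set T)) (kappa Y : nat -> T -> R) (nu : R).
Hypothesis hF : filtration F.
Hypothesis predictable_kappa : forall n, measurable_wrt (F n) (kappa n).
Hypothesis adaptedY : forall n, measurable_wrt (F n.+1) (Y n).

Lemma adapted_wealth n : measurable_wrt (F n) (wealth kappa Y nu n).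
Proof.
apply: measurable_prod => i _.
apply: measurable_funD => //; apply: measurable_funM.
  by apply: adapted_later (@predictable_kappa i) => //; exact: ltnW.
by apply: measurable_funB => //; apply: adapted_later (@adaptedY i).
Qed.

Hypothesis kappa0 : forall n w, 0 <= kappa n w.
Hypothesis kappa_nu : forall n w, kappa n w * nu <= 1.
Hypothesis Y0 : forall n w, 0 <= Y n w.

(** The worst case [Y = 0] leaves the factor [1 - kappa * nu]. *)
Lemma wealth_ge0 n w : 0 <= wealth kappa Y nu n w.
Proof.
apply: prodr_ge0 => i _.
have := kappa_nu i w; have := mulr_ge0 (kappa0 i w) (Y0 i w); lra.
Qed.

Variable P : probability T R.
Hypothesis nu0 : 0 <= nu.
Hypothesis condY : forall n A, F n A ->
  (\int[P]_(w in A) (Y n w)%:E = nu%:E * P A)%E.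

(** The martingale property, as equality of integrals over past events.  The
next wealth on [E] is [Z1 + Z2 * Y] with [Z1], [Z2] nonnegative and known at
time [n]; pulling out [Z2] replaces [Y] by [nu] and the [kappa] terms cancel. *)
Lemma wealth_martingale n E : F n E ->
  (\int[P]_(w in E) (wealth kappa Y nu n.+1 w)%:E =
   \int[P]_(w in E) (wealth kappa Y nu n w)%:E)%E.
Proof.
move=> FE.
have intE (f : T -> R) :
    (\int[P]_(w in E) (f w)%:E = \int[P]_w (f w * \1_E w)%:E)%E.
  rewrite integral_mkcond; apply: eq_integral => w _.
  by rewrite patchE indicE; case: ifP => _; rewrite ?mulr1 ?mulr0.
rewrite !intE.
pose W := wealth kappa Y nu n.
pose Z1 w := W w * (1 - kappa n w * nu) * \1_E w.
pose Z2 w := W w * kappa n w * \1_E w.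
have mW : measurable_wrt (F n) W := @adapted_wealth n.
have m1 : measurable_wrt (F n) (\1_E : T -> R).
  by apply: measurable_indic; exact: sub_sigma_algebra.
have mZ1 : measurable_wrt (F n) Z1.
  apply: measurable_funM => //; apply: measurable_funM => //.
  apply: measurable_funB => //; apply: measurable_funM => //.
  exact: predictable_kappa.
have mZ2 : measurable_wrt (F n) Z2.
  apply: measurable_funM => //; apply: measurable_funM => //.
  exact: predictable_kappa.
have Z10 w : 0 <= Z1 w.
  by rewrite !mulr_ge0// ?wealth_ge0// subr_ge0.
have Z20 w : 0 <= Z2 w by rewrite !mulr_ge0// wealth_ge0.
have mT (f : T -> R) : measurable_wrt (F n) f -> measurable_fun setT f.
  exact: adapted_measurable.
have mY : measurable_fun setT (Y n) by exact: adapted_measurable (@adaptedY n).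
transitivity (\int[P]_w ((Z1 w)%:E + (Z2 w * Y n w)%:E))%E.
  apply: eq_integral => w _; rewrite -EFinD; congr EFin.
  by rewrite /wealth big_ord_recr/= /Z1 /Z2 /W /wealth; ring.
rewrite ge0_integralD//; first last.
- by apply/measurable_EFinP; apply: measurable_funM => //; exact: mT.
- by move=> w _; rewrite lee_fin mulr_ge0.
- by apply/measurable_EFinP; exact: mT.
- by move=> w _; rewrite lee_fin.
rewrite (pull_out (proj1 hF n) mY (Y0 n) (@condY n) mZ2 Z20).
rewrite -ge0_integralZl//; first last.
- by move=> w _; rewrite lee_fin.
- by apply/measurable_EFinP; exact: mT.
rewrite -ge0_integralD//; first last.
- by apply/measurable_EFinP; apply: measurable_funM => //; exact: mT.
- by move=> w _; rewrite lee_fin mulr_ge0.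
- by apply/measurable_EFinP; exact: mT.
- by move=> w _; rewrite lee_fin.
apply: eq_integral => w _; rewrite -EFinM -EFinD; congr EFin.
by rewrite /Z1 /Z2 /W; ring.
Qed.

End wealth_martingale.

(** * Dependence of the wealth on the candidate mean *)

Section truncated_bets.
Context {R : realType}.
Implicit Types (c m x : R) (l : nat -> sample_space R -> R).

Lemma lambda_plusE c l m n w : lambda_plus c l m n w =
  if m == 0 then `|l n w| else Num.min `|l n w| (c / m).
Proof.
rewrite /lambda_plus /ratio; case: ifP => _; first by rewrite miney.
by rewrite -EFin_min.
Qed.

Lemma lambda_plus_ge0 c l m n w :
  0 <= c -> 0 <= m -> 0 <= lambda_plus c l m n w.
Proof.
move=> c0 m0; rewrite lambda_plusE; case: ifP => // _.
by rewrite le_min normr_ge0 divr_ge0.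
Qed.

Lemma lambda_plusM c l m n w : 0 <= c -> 0 <= m ->
  lambda_plus c l m n w * m = Num.min (`|l n w| * m) c.
Proof.
move=> c0 m0; rewrite lambda_plusE; case: eqP => [->|/eqP mN0].
  by rewrite mulr0 min_l.
by rewrite minr_pMl// divfK.
Qed.

Lemma lambda_plusM_le1 c l m n w : 0 <= c < 1 -> 0 <= m ->
  lambda_plus c l m n w * m <= 1.
Proof.
by move=> /andP[c0 c1] m0; rewrite lambda_plusM// ge_min (ltW c1) orbT.
Qed.

Lemma lambda_plus_antitone c l m m' n w : 0 <= c -> 0 <= m <= m' ->
  lambda_plus c l m' n w <= lambda_plus c l m n w.
Proof.
move=> c0 /andP[m0 mm']; rewrite !lambda_plusE.
have [m_eq0|mN0] := eqVneq m 0.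
  by case: ifP => // _; rewrite ge_min lexx.
have m_gt0 : 0 < m by rewrite lt_neqAle eq_sym mN0.
have m'_gt0 := lt_le_trans m_gt0 mm'.
rewrite gt_eqF// le_min !ge_min lexx/= ler_wpM2l ?orbT//.
by rewrite lef_pV2.
Qed.

(** The factor is [1 - lambda * m + lambda * X]: raising [m] lowers [lambda] and
raises [lambda * m], and [X] is nonnegative.  The factors must also be
nonnegative for the inequality to pass to their product. *)
Lemma wealth_antitone c l (X : nat -> sample_space R -> R) m m' t w :
  0 <= c < 1 -> 0 <= m <= m' -> (forall n w, 0 <= X n w) ->
  wealth (lambda_plus c l m') X m' t w <= wealth (lambda_plus c l m) X m t w.
Proof.
move=> c01 mm' X0; have /andP[c0 c1] := c01; have /andP[m0 le_mm'] := mm'.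
have m'0 : 0 <= m' := le_trans m0 le_mm'.
apply: ler_prod => i _; rewrite !mulrBr; apply/andP; split.
  have := lambda_plusM_le1 l i w c01 m'0.
  by have := mulr_ge0 (lambda_plus_ge0 l i w c0 m'0) (X0 i w); lra.
have : lambda_plus c l m i w * m <= lambda_plus c l m' i w * m'.
  rewrite !lambda_plusM// le_min !ge_min lexx orbT andbT.
  by rewrite ler_wpM2l.
have := ler_wpM2r (X0 i w) (lambda_plus_antitone l i w c0 mm'); lra.
Qed.

(** Betting against [X] with candidate mean [m] is betting on [1 - X] with
candidate mean [1 - m]; this symmetry transports every fact on [K_plus]. *)
Lemma K_minusE c l t m w : K_minus c l t m w =
  wealth (lambda_plus c l (1 - m)) (fun n w => 1 - coord n w) (1 - m) t w.
Proof.
apply: eq_bigr => i _.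
by rewrite (_ : lambda_minus c l m = lambda_plus c l (1 - m))//; ring.
Qed.

Lemma coord_ge0 n (w : sample_space R) : 0 <= coord n w.
Proof. by rewrite /coord. Qed.

Lemma coord_le1 n (w : sample_space R) : coord n w <= 1.
Proof. by rewrite /coord. Qed.

Lemma one_minus_coord_ge0 n (w : sample_space R) : 0 <= 1 - coord n w.
Proof. by rewrite subr_ge0 coord_le1. Qed.

Lemma K_plus_antitone c l t m m' w : 0 <= c < 1 -> 0 <= m <= m' ->
  K_plus c l t m' w <= K_plus c l t m w.
Proof. by move=> c01 mm'; apply: wealth_antitone => //; exact: coord_ge0. Qed.

Lemma K_minus_monotone c l t m m' w : 0 <= c < 1 -> m <= m' <= 1 ->
  K_minus c l t m w <= K_minus c l t m' w.
Proof.
move=> c01 /andP[mm' m'1]; rewrite !K_minusE; apply: wealth_antitone => //.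
  by rewrite subr_ge0 m'1 lerB.
exact: one_minus_coord_ge0.
Qed.

Lemma K_plus_ge0 c l t m w : 0 <= c < 1 -> 0 <= m -> 0 <= K_plus c l t m w.
Proof.
move=> c01 m0; have /andP[c0 _] := c01; apply: wealth_ge0 => *.
- exact: lambda_plus_ge0.
- exact: lambda_plusM_le1.
- exact: coord_ge0.
Qed.

Lemma K_minus_ge0 c l t m w : 0 <= c < 1 -> m <= 1 -> 0 <= K_minus c l t m w.
Proof.
move=> c01; rewrite -subr_ge0 K_minusE => m0; have /andP[c0 _] := c01.
apply: wealth_ge0 => *.
- exact: lambda_plus_ge0.
- exact: lambda_plusM_le1.
- exact: one_minus_coord_ge0.
Qed.

End truncated_bets.

(** * Convexity of the sets and their inclusion *)

Section intervals.
Context {R : realType}.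

Lemma interval01_between (A : set R) : A `<=` `[0, 1] ->
  (forall x y z, A x -> A y -> x <= z <= y -> A z) -> interval01 A.
Proof.
move=> A01 betw; split=> // x y k; rewrite !inE => Ax Ay.
have k0 : 0 <= k%:num by [].
have k1 : k%:num <= 1 by [].
set z := conv _ _ _.
have zE : z = k%:num * x + (1 - k%:num) * y :> R by [].
have [xy|yx] := leP (x : R) y.
  apply: betw Ax Ay _; rewrite zE; apply/andP; split.
    have := mulr_ge0 (_ : 0 <= 1 - k%:num) (_ : 0 <= (y : R) - x); nra.
  nra.
apply: betw Ay Ax _; rewrite zE; apply/andP; split; nra.
Qed.

(** For a point between two members, [K_plus] is controlled by the left member
and [K_minus] by the right one. *)
Lemma B_pm_interval (alpha theta c : R) lp lm t w :
  0 <= theta <= 1 -> 0 <= c < 1 -> interval01 (B_pm alpha theta c lp lm t w).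
Proof.
move=> /andP[th0 th1] c01; apply: interval01_between => [m [m01 _]|x y z].
  by rewrite /= in_itv.
move=> [/andP[x0 x1]]; rewrite /K_pm gt_max => /andP[Kx _].
move=> [/andP[y0 y1]]; rewrite gt_max => /andP[_ Ky] /andP[xz zy].
split; first by rewrite (le_trans x0 xz) (le_trans zy y1).
rewrite gt_max; apply/andP; split.
  apply: le_lt_trans Kx; rewrite ler_wpM2l//.
  by apply: K_plus_antitone => //; rewrite x0.
apply: le_lt_trans Ky; rewrite ler_wpM2l ?subr_ge0//.
by apply: K_minus_monotone => //; rewrite zy.
Qed.

Lemma K_pm_le_M_pm (theta c m : R) lp lm t w :
  0 <= theta <= 1 -> 0 <= c < 1 -> 0 <= m <= 1 ->
  K_pm theta c lp lm t m w <= M_pm theta c lp lm t m w.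
Proof.
move=> /andP[th0 th1] c01 /andP[m0 m1].
have Kp := K_plus_ge0 lp t w c01 m0.
have Km := K_minus_ge0 lm t w c01 m1.
rewrite /K_pm /M_pm ge_max lerDl lerDr.
by rewrite !mulr_ge0// subr_ge0.
Qed.

Lemma BM_pm_sub_B_pm (alpha theta c : R) lp lm t w :
  0 <= theta <= 1 -> 0 <= c < 1 ->
  BM_pm alpha theta c lp lm t w `<=` B_pm alpha theta c lp lm t w.
Proof.
move=> th c01 m [m01 Mm]; split=> //; apply: le_lt_trans Mm.
exact: K_pm_le_M_pm.
Qed.

End intervals.

(** * Measurability with respect to the observations *)

Section history_filtration.
Context {R : realType}.
Implicit Types (l : nat -> sample_space R -> R) (c m : R).

Lemma adapted_coord n : measurable_wrt (history n.+1) (@coord R n).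
Proof.
move=> _ B mB; apply: sub_sigma_algebra; apply: sub_sigma_algebra.
rewrite -bigcup_mkord_ord; exists n; first exact: ltnSn.
by exists B => //; rewrite inordK.
Qed.

Lemma history_filtration : filtration (@history R).
Proof.
split=> n; last first.
  apply: smallest_sub; first exact: smallest_sigma_algebra.
  apply: subset_trans (@sub_sigma_algebra _ _ _).
  rewrite [X in _ `<=` X]big_ord_recr/=; exact: subsetUl.
split; first exact: smallest_sigma_algebra.
apply: smallest_sub; first exact: sigma_algebra_measurable.
elim/big_ind: _ => //[A B HA HB|i _]; first by rewrite subUset.
by move=> A Ai; apply: sub_sigma_algebra; exists i.
Qed.

Lemma predictable_lambda_plus c l m n :
  predictable l -> measurable_wrt (history n) (lambda_plus c l m n).
Proof.
move=> hl; have mabs : measurable_wrt (history n) (fun w => `|l n w|).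
  by apply: measurableT_comp => //; exact: hl.
rewrite (_ : lambda_plus c l m n =
    fun w => if m == 0 then `|l n w| else Num.min `|l n w| (c / m)).
  by case: (m == 0) => //; exact: measurable_minr.
by apply/funext => w; exact: lambda_plusE.
Qed.

Lemma adapted_K_plus c l t m :
  predictable l -> measurable_wrt (history t) (K_plus c l t m).
Proof.
move=> hl; apply: (adapted_wealth (kappa := lambda_plus c l m)
    (Y := @coord R) m history_filtration) => n.
- exact: predictable_lambda_plus.
- exact: adapted_coord.
Qed.

Lemma adapted_K_minus c l t m :
  predictable l -> measurable_wrt (history t) (K_minus c l t m).
Proof.
move=> hl; rewrite (_ : K_minus c l t m = wealth (lambda_plus c l (1 - m))
    (fun n w => 1 - coord n w) (1 - m) t); last first.
  by apply/funext => w; exact: K_minusE.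
apply: (adapted_wealth (kappa := lambda_plus c l (1 - m))
    (Y := fun n w => 1 - coord n w) (1 - m) history_filtration) => n.
- exact: predictable_lambda_plus.
- by apply: measurable_funB => //; exact: adapted_coord.
Qed.

Lemma history_event (f : sample_space R -> R) t m (a : R) :
  measurable_wrt (history t) f -> history t [set w | 0 <= m <= 1 /\ f w < a].
Proof.
move=> mf; have sH := filtration_sigma_algebra history_filtration t.
have [m01|m01] := boolP (0 <= m <= 1); last first.
  rewrite (_ : [set _ | _] = set0); first by case: sH.
  by apply/seteqP; split=> // w [].
rewrite (_ : [set _ | _] = f @^-1` `]-oo, a[).
  exact: measurable_wrt_preimage.
by apply/seteqP; split=> w /=; rewrite in_itv /=; [case|].
Qed.

End history_filtration.

(** * The mixture martingale under a law with mean [mu] *)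

Section mean_class.
Context {R : realType}.
Variables (mu : R) (P : probability (sample_space R) R).
Hypothesis hmu : 0 <= mu <= 1.
Hypothesis hP : mean_class mu P.

Lemma integral_coord n A : history n A ->
  (\int[P]_(w in A) (coord n w)%:E = mu%:E * P A)%E.
Proof.
move=> hA; have [_ _ <-//] := hP n.
apply: (@integral_cst _ _ _ P A _ mu%:E).
exact: (filtration_measurable history_filtration hA).
Qed.

Lemma integral_one_minus_coord n A : history n A ->
  (\int[P]_(w in A) (1 - coord n w)%:E = (1 - mu)%:E * P A)%E.
Proof.
move=> hA; have mA := filtration_measurable history_filtration hA.
have mX : measurable_fun A (@coord R n).
  apply: measurable_funTS.
  exact: (adapted_measurable history_filtration (@adapted_coord R n)).
have : (\int[P]_(w in A) (coord n w)%:E +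
        \int[P]_(w in A) (1 - coord n w)%:E = P A)%E.
  (* The integrals of the nonnegative X and 1 - X add up in [0, +oo]; the first
     one is finite, so the second can be solved for afterwards. *)
  rewrite -ge0_integralD//; first last.
  - by apply/measurable_EFinP; exact: measurable_funB.
  - by move=> w _; rewrite lee_fin one_minus_coord_ge0.
  - exact/measurable_EFinP.
  - by move=> w _; rewrite lee_fin coord_ge0.
  rewrite -[RHS]mul1e -integral_cst//; apply: eq_integral => w _.
  by rewrite -EFinD addrC subrK.
rewrite integral_coord// -(@fineK _ (P A)) ?fin_num_measure//.
case: (\int[P]_(w in A) _)%E => [r| |]//= [] H.
by rewrite -EFinM; congr EFin; lra.
Qed.

Variables (theta c : R) (lp lm : nat -> sample_space R -> R).
Hypotheses (htheta : 0 <= theta <= 1) (hc : 0 <= c < 1).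
Hypotheses (hlp : predictable lp) (hlm : predictable lm).

Lemma K_plus_martingale n E : history n E ->
  (\int[P]_(w in E) (K_plus c lp n.+1 mu w)%:E =
   \int[P]_(w in E) (K_plus c lp n mu w)%:E)%E.
Proof.
have [/andP[mu0 mu1] /andP[c0 _]] := (hmu, hc).
apply: (wealth_martingale history_filtration) => *.
- exact: predictable_lambda_plus.
- exact: adapted_coord.
- exact: lambda_plus_ge0.
- exact: lambda_plusM_le1.
- exact: coord_ge0.
- by [].
- exact: integral_coord.
Qed.

Lemma K_minus_martingale n E : history n E ->
  (\int[P]_(w in E) (K_minus c lm n.+1 mu w)%:E =
   \int[P]_(w in E) (K_minus c lm n mu w)%:E)%E.
Proof.
have [/andP[mu0 mu1] /andP[c0 _]] := (hmu, hc).
have nu0 : 0 <= 1 - mu by rewrite subr_ge0.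
under eq_integral do rewrite K_minusE.
under [RHS]eq_integral do rewrite K_minusE.
apply: (wealth_martingale history_filtration) => *.
- exact: predictable_lambda_plus.
- by apply: measurable_funB => //; exact: adapted_coord.
- exact: lambda_plus_ge0.
- exact: lambda_plusM_le1.
- exact: one_minus_coord_ge0.
- by [].
- exact: integral_one_minus_coord.
Qed.

Lemma adapted_M_pm n m : measurable_wrt (history n) (M_pm theta c lp lm n m).
Proof.
apply: measurable_funD; apply: measurable_funM => //.
  exact: adapted_K_plus.
exact: adapted_K_minus.
Qed.

Lemma M_pm_ge0 n w : 0 <= M_pm theta c lp lm n mu w.
Proof.
have [/andP[mu0 mu1] /andP[th0 th1]] := (hmu, htheta).
by rewrite addr_ge0// mulr_ge0// ?subr_ge0// ?K_plus_ge0// K_minus_ge0.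
Qed.

Lemma M_pm_martingale n E : history n E ->
  (\int[P]_(w in E) (M_pm theta c lp lm n.+1 mu w)%:E =
   \int[P]_(w in E) (M_pm theta c lp lm n mu w)%:E)%E.
Proof.
move=> hE; have [/andP[mu0 mu1] /andP[th0 th1]] := (hmu, htheta).
have mE := filtration_measurable history_filtration hE.
have mp k : measurable_fun E (EFin \o K_plus c lp k mu).
  apply/measurable_EFinP; apply: measurable_funTS.
  apply: (adapted_measurable (n := k) history_filtration).
  exact: adapted_K_plus.
have mm k : measurable_fun E (EFin \o K_minus c lm k mu).
  apply/measurable_EFinP; apply: measurable_funTS.
  apply: (adapted_measurable (n := k) history_filtration).
  exact: adapted_K_minus.
have split_M k : (\int[P]_(w in E) (M_pm theta c lp lm k mu w)%:E =
    theta%:E * \int[P]_(w in E) (K_plus c lp k mu w)%:E +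
    (1 - theta)%:E * \int[P]_(w in E) (K_minus c lm k mu w)%:E)%E.
  have Kp0 w : E w -> (0 <= (K_plus c lp k mu w)%:E)%E.
    by move=> _; rewrite lee_fin K_plus_ge0.
  have Km0 w : E w -> (0 <= (K_minus c lm k mu w)%:E)%E.
    by move=> _; rewrite lee_fin K_minus_ge0.
  rewrite -!ge0_integralZl ?lee_fin ?subr_ge0//.
  rewrite -ge0_integralD//.
  - by move=> w Ew; rewrite mule_ge0 ?Kp0// lee_fin.
  - by apply: measurable_funeM; exact: mp.
  - by move=> w Ew; rewrite mule_ge0 ?Km0// lee_fin subr_ge0.
  - by apply: measurable_funeM; exact: mm.
  - exact: mm.
  - exact: mp.
by rewrite !split_M K_plus_martingale// K_minus_martingale.
Qed.

Lemma M_pm_ville (alpha : R) : 0 < alpha ->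
  (P [set w | exists n, (1 / alpha <= M_pm theta c lp lm n mu w)%R] <=
   alpha%:E)%E.
Proof.
move=> a0.
have superM n E : history n E ->
    (\int[P]_(w in E) (M_pm theta c lp lm n.+1 mu w)%:E <=
     \int[P]_(w in E) (M_pm theta c lp lm n mu w)%:E)%E.
  by move=> hE; rewrite M_pm_martingale.
have := ville history_filtration (fun n => @adapted_M_pm n mu) M_pm_ge0 superM
  (ltW (divr_gt0 ltr01 a0)).
have -> : (\int[P]_w (M_pm theta c lp lm 0 mu w)%:E = 1)%E.
  under eq_integral do
    rewrite /M_pm /K_plus /K_minus !big_ord0 !mulr1 addrC subrK.
  by rewrite integral_cst// mul1e; exact: probability_setT.
by rewrite div1r muleC -lee_pdivlMr ?invr_gt0// invrK mul1e.
Qed.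

End mean_class.

(** * Confidence sequences *)

Section confidence_sequences.
Context {R : realType}.
Variables (alpha mu : R).
Implicit Types C : nat -> sample_space R -> set R.

Definition determined C := forall t m, (0 < t)%N -> history t [set w | C t w m].

Lemma measurable_miss C : determined C ->
  measurable [set w | exists2 t, (0 < t)%N & ~ C t w mu].
Proof.
move=> dC; rewrite (_ : [set _ | _] =
    \bigcup_t ~` [set w | (0 < t)%N -> C t w mu]); last first.
  apply/seteqP; split=> w /=.
    by move=> [t t0 nC]; exists t => //= /(_ t0).
  by move=> [t _ /not_implyP[t0 nC]]; exists t.
apply: bigcupT_measurable => t; apply: measurableC.
case: (posnP t) => [->|t0].
  by rewrite (_ : [set _ | _] = setT)//; apply/seteqP; split.
rewrite (_ : [set _ | _] = [set w | C t w mu]).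
  exact: (filtration_measurable history_filtration (dC t mu t0)).
by apply/seteqP; split=> w //= h; exact: h.
Qed.

Lemma confidence_sequence_bound C : determined C ->
  (forall P, mean_class mu P ->
    (P [set w | exists2 t, (0 < t)%N & ~ C t w mu] <= alpha%:E)%E) ->
  confidence_sequence alpha mu C.
Proof.
by move=> dC bC; split=> //; apply: ge_ereal_sup => _ [P hP <-]; exact: bC.
Qed.

(** Only the coverage of [mu] itself matters, so the inclusion is required at
[mu] alone. *)
Lemma confidence_sequenceW C C' : determined C' ->
  (forall t w, (0 < t)%N -> C t w mu -> C' t w mu) ->
  confidence_sequence alpha mu C -> confidence_sequence alpha mu C'.
Proof.
move=> dC' CC' [dC bC]; apply: confidence_sequence_bound => // P hP.
apply: le_trans bC; apply: le_trans (ereal_sup_ubound _); last by exists P.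
apply: le_measure; rewrite ?inE; try exact: measurable_miss.
by move=> w [t t0 nC]; exists t => //; apply: contra_not nC; exact: CC'.
Qed.

(** Intersecting costs no coverage, since coverage is already required at all
times simultaneously. *)
Lemma confidence_running_intersection C : confidence_sequence alpha mu C ->
  confidence_sequence alpha mu (running_intersection C).
Proof.
move=> [dC bC].
have miss_eq :
    [set w | exists2 t, (0 < t)%N & ~ running_intersection C t w mu] =
    [set w | exists2 t, (0 < t)%N & ~ C t w mu].
  apply/seteqP; split=> w [t t0 nC]; last first.
    by exists t => //; apply: contra_not nC => /(_ t); apply; rewrite /= t0 /=.
  have [i] := (existsNP _).2 nC.
  by move=> /not_implyP[/andP[i0 _] nCi]; exists i.
apply: confidence_sequence_bound => [t m t0|P hP]; last first.
  by rewrite miss_eq; apply: le_trans bC; apply: ereal_sup_ubound; exists P.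
have sH := filtration_sigma_algebra (@history_filtration R) t.
rewrite (_ : [set w | _] = \bigcap_(i in [set i | (0 < i <= t)%N])
    [set w | C i w m]) //.
rewrite -(measurable_g_measurableTypeE sH).
apply: bigcap_measurable => [|i /andP[i0 it]].
  by exists t; rewrite /= t0 /=.
apply: sub_sigma_algebra.
by apply: (filtration_le (@history_filtration R) it); exact: dC.
Qed.

End confidence_sequences.

Theorem theorem3 (R : realType) (alpha theta c mu : R)
    (lp lm : nat -> sample_space R -> R)
    (halpha : 0 < alpha < 1) (htheta : 0 <= theta <= 1)
    (hc : 0 <= c < 1) (hmu : 0 <= mu <= 1)
    (hlp : predictable lp) (hlm : predictable lm) :
  [/\ confidence_sequence alpha mu (B_pm alpha theta c lp lm),
      confidence_sequence alpha mu
        (running_intersection (B_pm alpha theta c lp lm)),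
      forall t w, (0 < t)%N -> interval01 (B_pm alpha theta c lp lm t w),
      confidence_sequence alpha mu (BM_pm alpha theta c lp lm) &
      forall t w, (0 < t)%N ->
        BM_pm alpha theta c lp lm t w `<=` B_pm alpha theta c lp lm t w].
Proof.
have dBM : determined (BM_pm alpha theta c lp lm).
  by move=> t m _; apply: history_event; exact: adapted_M_pm.
have dB : determined (B_pm alpha theta c lp lm).
  move=> t m _; apply: history_event; apply: measurable_maxr;
    apply: measurable_funM => //.
    exact: adapted_K_plus.
  exact: adapted_K_minus.
have csM : confidence_sequence alpha mu (BM_pm alpha theta c lp lm).
  apply: confidence_sequence_bound => // P hP; have /andP[a0 _] := halpha.
  apply: le_trans (M_pm_ville hmu hP htheta hc hlp hlm a0).
  apply: le_measure; rewrite ?inE; first exact: measurable_miss.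
    apply: (measurable_crossing (@history_filtration R)) => n.
    exact: adapted_M_pm.
  move=> w [t _ nBM]; exists t; rewrite leNgt; apply/negP => Mlt.
  by apply: nBM; split.
have csB : confidence_sequence alpha mu (B_pm alpha theta c lp lm).
  apply: confidence_sequenceW csM => // t w _.
  exact: BM_pm_sub_B_pm.
split=> //.
- exact: confidence_running_intersection.
- by move=> t w _; exact: B_pm_interval.
- by move=> t w _; exact: BM_pm_sub_B_pm.
Qed.
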